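(* Let $n\ge0$ and $\sigma\in C_{2n}(123)$. The $y$-coordinate of the last point of the lattice path $\Phi(\sigma)$ equals twice the number of tiny minima of $\sigma$.
   Context: $C_{2n}(123)$ is the set of permutations $\sigma$ of $[2n]=\{1,\dots,2n\}$ with $\sigma(i)+\sigma(2n+1-i)=2n+1$ for all $i$ and no $i<j<k$ with $\sigma(i)<\sigma(j)<\sigma(k)$. A Dyck prefix of length $m$ is a word in $U=(1,1)$, $D=(1,-1)$ of length $m$ whose lattice path from the origin never goes below the $x$-axis. For a set $S=\{s_1<\dots<s_r\}$ and a permutation $\tau$ of $[r]$, the word on $S$ order-isomorphic to $\tau$ is $s_{\tau(1)}\cdots s_{\tau(r)}$. Define $\Psi$ recursively from Dyck prefixes of length $2n$ to permutations of $[2n]$: the empty prefix goes to the empty permutation; for nonempty $\pi=U^jD^k\pi'$ ($j\ge1,k\ge0$ maximal), $\sigma=\Psi(\pi)$ is: (a) if $j\le n$: $\sigma(1)=2n+1-j$, $\sigma(i)=2n+2-i$ ($2\le i\le k$), $\sigma(2n)=j$, $\sigma(2n-i)=i$ ($1\le i\le k-1$), and $\sigma(k+1)\cdots\sigma(2n-k)$ is the word on $[2n]\setminus\{1,\dots,k-1,j,2n+1-j,2n-k+2,\dots,2n\}$ order-isomorphic to $\Psi(U^{j-k}\pi')$; (b) if $j=n+1$: $\sigma(1)=n$, $\sigma(i)=2n+2-i$ ($2\le i\le k+1$), $\sigma(2n)=n+1$, $\sigma(2n-i)=i$ ($1\le i\le k$), and $\sigma(k+2)\cdots\sigma(2n-k-1)$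 is the word on $[2n]\setminus\{1,\dots,k,n,n+1,2n-k+1,\dots,2n\}$ order-isomorphic to $\Psi(U^{n-k-1}\pi')$; (c) if $j\ge n+2$: $\sigma(1)=n$, $\sigma(2n)=n+1$, and $\sigma(2)\cdots\sigma(2n-1)$ is the word on $[2n]\setminus\{n,n+1\}$ order-isomorphic to $\Psi(U^{j-2}D^k\pi')$. The paper shows $\Psi$ is a bijection onto $C_{2n}(123)$; $\Phi$ denotes its inverse. Tiny minima: let $w(\sigma)=\sigma(1)\cdots\sigma(n)=x_1w_1\cdots x_sw_s$, where $x_1,\dots,x_s$ are the values of the left-to-right minima of $\sigma$ (positions $i$ with $\sigma(i)\le\sigma(j)$ for all $j\le i$) among the first $n$ positions and $w_i$ is the possibly empty word between $x_i$ and $x_{i+1}$ (or the end). Let $A_0=[2n]$ and let $A_i$ be obtained from $A_{i-1}$ by removing $x_i$, $2n+1-x_i$, the entries of $w_i$ and their complements $2n+1-a$. For $A=\{s_1<\dots<s_{2h}\}$ put $m(A)=s_h$. The minimum $x_i$ is tiny if $x_i=m(A_{i-1})$. *)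

(* Defs.v *)
From HB Require Import structures.
From mathcomp Require Import all_boot all_order all_algebra all_fingroup.
From mathcomp Require Import zify.

Set Implicit Arguments.
Unset Strict Implicit.
Unset Printing Implicit Defensive.

Import GRing.Theory.

(* ['S_(n.*2)] is 0-based: the paper's sigma(i) is [(s (i - 1)).+1]. The      *)
(* 0-based form of sigma(i) + sigma(2n+1-i) = 2n+1 is written with [rev_ord]. *)
Definition C123 (n : nat) : {set 'S_(n.*2)} :=
  [set s : 'S_(n.*2) |
    [forall i : 'I_(n.*2), (s i).+1 + (s (rev_ord i)).+1 == n.*2.+1] &&
    ~~ [exists i : 'I_(n.*2), exists j : 'I_(n.*2), exists k : 'I_(n.*2),
        [&& i < j, j < k, s i < s j & s j < s k]]].

(* sigma(1) ... sigma(m), with values in {1, ..., m} *)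
Definition one_line (m : nat) (s : 'S_m) : seq nat :=
  [seq (s i).+1 | i <- enum 'I_m].

(* Lattice paths are words over [bool]: [true] is U = (1, 1) and [false] is   *)
(* D = (1, -1).                                                               *)
Definition height (p : seq bool) : int :=
  (\sum_(u <- p) (if u then 1 else -1))%R.

Definition dyck_prefix (p : seq bool) : bool :=
  all (fun i => (0 <= height (take i p))%R) (iota 0 (size p).+1).

(* S lists a set increasingly and t is a permutation of {1, ..., size S}. *)
Definition word_on (S t : seq nat) : seq nat :=
  [seq nth 0 S i.-1 | i <- t].

(* [2n] \ r *)
Definition interval_minus (n : nat) (r : seq nat) : seq nat :=
  [seq v <- iota 1 n.*2 | v \notin r].

(* One step of the recursion for Psi, [rec] standing for the recursive calls. *)
(* [iota a l] is the word a, a+1, ..., a+l-1.                                 *)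
Definition Psi_step (rec : seq bool -> seq nat) (p : seq bool) : seq nat :=
  if p is [::] then [::] else
  let n := (size p)./2 in
  let j := find negb p in
  let k := find id (drop j p) in
  let p' := drop (j + k) p in
  if j <= n then
    (n.*2.+1 - j) :: [seq n.*2.+2 - i | i <- iota 2 k.-1]
    ++ word_on
         (interval_minus n
            (iota 1 k.-1 ++ [:: j; n.*2.+1 - j] ++ iota (n.*2.+2 - k) k.-1))
         (rec (nseq (j - k) true ++ p'))
    ++ rev (iota 1 k.-1) ++ [:: j]
  else if j == n.+1 then
    n :: [seq n.*2.+2 - i | i <- iota 2 k]
    ++ word_on
         (interval_minus n
            (iota 1 k ++ [:: n; n.+1] ++ iota (n.*2.+1 - k) k))
         (rec (nseq (n - k.+1) true ++ p'))
    ++ rev (iota 1 k) ++ [:: n.+1]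
  else
    n :: word_on (interval_minus n [:: n; n.+1])
                 (rec (nseq (j - 2) true ++ nseq k false ++ p'))
    ++ [:: n.+1].

(* The recursive calls are on strictly shorter words, so the fuel [size p]    *)
(* never runs out; see [PsiE].                                                *)
Fixpoint Psi_fuel (f : nat) (p : seq bool) : seq nat :=
  if f is f'.+1 then Psi_step (Psi_fuel f') p else [::].

Definition Psi (p : seq bool) : seq nat := Psi_fuel (size p) p.

Lemma Psi_step_ext (f g : seq bool -> seq nat) (p : seq bool) :
  (forall q, size q < size p -> f q = g q) -> Psi_step f p = Psi_step g p.
Proof.
case: p => [//|u p0] Hfg; rewrite /Psi_step.
set p := u :: p0 in Hfg *.
have sp : 0 < size p by [].
move: (sp); have := find_size negb p.
have := find_size id (drop (find negb p) p); rewrite size_drop.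
have k0 : find negb p < size p -> 0 < find id (drop (find negb p) p).
  move=> ltj; rewrite (drop_nth false) //=.
  by have := ltj; rewrite -has_find => /(nth_find false) /negbTE ->.
move: k0; set j := find negb p; set k := find _ _ => k0 lek lej _.
case: leqP => [lejn|ltnj].
  have {}k0 : 0 < k by apply: k0; lia.
  by rewrite Hfg // size_cat size_nseq size_drop; lia.
case: eqP => [jn|njn]; rewrite Hfg //.
  by rewrite size_cat size_nseq size_drop; lia.
by rewrite !size_cat !size_nseq size_drop; lia.
Qed.

Lemma PsiE (p : seq bool) : Psi p = Psi_step Psi p.
Proof.
have fuelE f g q : size q <= f -> size q <= g -> Psi_fuel f q = Psi_fuel g q.
  elim: f g q => [|f IH] [|g] [|v q] // Hf Hg.
  change (Psi_step (Psi_fuel f) (v :: q) = Psi_step (Psi_fuel g) (v :: q)).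
  by apply: Psi_step_ext => r Hr; apply: IH; move: Hr Hf Hg => /=; lia.
case: p => [//|u p].
change (Psi_step (Psi_fuel (size p)) (u :: p) = Psi_step Psi (u :: p)).
by apply: Psi_step_ext => q Hq; apply: fuelE.
Qed.

(* The inverse of Psi. The default value is a dummy: Psi is a bijection from  *)
(* Dyck prefixes of length 2n onto C_{2n}(123), so [pick] selects the unique  *)
(* preimage of any s in [C123 n].                                             *)
Definition Phi (n : nat) (s : 'S_(n.*2)) : (n.*2).-tuple bool :=
  odflt [tuple of nseq n.*2 true]
    [pick p : (n.*2).-tuple bool | dyck_prefix p & Psi p == one_line s].

Definition ltr_min (w : seq nat) (i : nat) : bool :=
  all (fun j => nth 0 w i <= nth 0 w j) (iota 0 i.+1).

Section TinyMinima.
Variables (n : nat) (s : 'S_(n.*2)).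

Definition half_word : seq nat := take n (one_line s).

(* the (0-based) positions of x_1, x_2, ... in w(sigma) *)
Definition min_positions : seq nat :=
  [seq i <- iota 0 n | ltr_min half_word i].

Definition num_minima : nat := size min_positions.

(* [min_value i] is x_{i+1} and [gap_word i] is w_{i+1} *)
Definition min_value (i : nat) : nat :=
  nth 0 half_word (nth n min_positions i).

Definition gap_word (i : nat) : seq nat :=
  [seq nth 0 half_word l |
     l <- iota 0 n & nth n min_positions i < l < nth n min_positions i.+1].

(* A_i, listed increasingly *)
Fixpoint remaining (i : nat) : seq nat :=
  if i is i'.+1 then
    let b := min_value i' :: gap_word i' in
    [seq v <- remaining i' | (v \notin b) && (v \notin [seq n.*2.+1 - a | a <- b])]
  else iota 1 n.*2.

(* m(A) = s_h for A = {s_1 < ... < s_2h} *)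
Definition lower_median (A : seq nat) : nat := nth 0 A (size A)./2.-1.

Definition tiny (i : nat) : bool := min_value i == lower_median (remaining i).

Definition num_tiny_minima : nat := count tiny (iota 0 num_minima).

End TinyMinima.

(* Main.v *)
(* If [sigma] is in C_2n(123) then [x = sigma(1)] is at least [n], and the
   entries between [x] and the next left-to-right minimum in the first half are
   [2n, 2n - 1, ..., 2n + 1 - g]: a missing larger value would come later and
   complete a 123 pattern. Deleting this block and its complements and
   standardizing what remains gives an element of C_2(n-g-1)(123); this is the
   inverse of one step of Psi, cases (a), (b), (c) being [x > n], [x = n] with
   [g > 0], and [x = n] with [g = 0]. The final height grows by 2 exactly when
   [x = n], that is when [x] is tiny, and since standardization preserves the
   complement symmetry it preserves the tininess of the later minima. *)
Require Import Defs.
From HB Require Import structures.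
From mathcomp Require Import all_boot all_order all_algebra all_fingroup.
From mathcomp Require Import zify.

Set Implicit Arguments.
Unset Strict Implicit.
Unset Printing Implicit Defensive.

(** * Removing the first block *)

(** The bounds place the block [x, 2n, ..., 2n + 1 - g] in the first half and keep [x] apart from
    its other entries and their complements. *)
Definition block_shape (n x g : nat) : bool := [&& g < n, n <= x & x + g <= n.*2].

(* The increasing bijection from [1, 2(n-g-1)] onto the values outside the
   first block [x, 2n, ..., 2n + 1 - g] and its complement. *)
Definition shift (n x g i : nat) : nat :=
  i + g + (minn x (n.*2.+1 - x) <= i + g) + (maxn x (n.*2.+1 - x) <= (i + g).+1).

Definition unshift (n x g v : nat) : nat :=
  v - g - (minn x (n.*2.+1 - x) < v) - (maxn x (n.*2.+1 - x) < v).

Definition kept (n x g v : nat) : bool :=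
  [&& g < v, v <= n.*2 - g, v != x & v != n.*2.+1 - x].

Lemma shift_mono n x g i j : i < j -> shift n x g i < shift n x g j.
Proof. by rewrite /shift; lia. Qed.

Lemma shift_le n x g i j : (shift n x g i <= shift n x g j) = (i <= j).
Proof. by rewrite /shift; lia. Qed.

Lemma shift_inj n x g : injective (shift n x g).
Proof. by move=> i j; rewrite /shift; lia. Qed.

Lemma shift_kept n x g i : block_shape n x g -> 0 < i <= (n - g.+1).*2 ->
  kept n x g (shift n x g i).
Proof. by rewrite /block_shape /kept /shift; lia. Qed.

(** The deleted values are closed under complement, so the increasing bijection onto the rest
    commutes with complements. *)
Lemma shift_compl n x g i : block_shape n x g -> 0 < i <= (n - g.+1).*2 ->
  n.*2.+1 - shift n x g i = shift n x g ((n - g.+1).*2.+1 - i).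
Proof. by rewrite /block_shape /shift; lia. Qed.

(** Each complementary pair has exactly one member at most [n], so [g + 1] values are deleted from
    the lower half. *)
Lemma shift_le_half n x g i : block_shape n x g -> 0 < i <= (n - g.+1).*2 ->
  (shift n x g i <= n) = (i <= n - g.+1).
Proof. by rewrite /block_shape /shift; lia. Qed.

Lemma unshiftK n x g v : block_shape n x g -> kept n x g v ->
  shift n x g (unshift n x g v) = v /\ 0 < unshift n x g v <= (n - g.+1).*2.
Proof. by rewrite /block_shape /kept /shift /unshift => ? ?; split; lia. Qed.

(** The cases of [Psi_step] list the deleted values differently, so [r] enters only through
    membership. Strictly increasing lists with the same members agree. *)
Lemma interval_minus_shift n x g r : block_shape n x g ->
  (forall v, 0 < v <= n.*2 -> (v \notin r) = kept n x g v) ->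
  interval_minus n r = [seq shift n x g i | i <- iota 1 (n - g.+1).*2].
Proof.
move=> sh Hr; apply: (irr_sorted_eq ltn_trans ltnn).
- by apply: sorted_filter; [apply: ltn_trans | apply: iota_ltn_sorted].
- rewrite sorted_map; apply: sub_sorted (iota_ltn_sorted _ _) => i j /=.
  exact: shift_mono.
move=> v; rewrite mem_filter mem_iota.
apply/andP/mapP => [[vr vn]|[i]].
- have kv : kept n x g v by rewrite -Hr //; lia.
  have [e b] := unshiftK sh kv.
  by exists (unshift n x g v) => //; rewrite mem_iota; lia.
- rewrite mem_iota => hi ->; have ki : kept n x g (shift n x g i).
    by apply: shift_kept => //; lia.
  rewrite Hr ?ki; move: ki; rewrite /kept; lia.
Qed.

Definition in_range (n : nat) (t : seq nat) : bool :=
  (size t == n.*2) && all (fun v => 0 < v <= n.*2) t.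

Lemma in_range_nth n t i : in_range n t -> i < n.*2 -> 0 < nth 0 t i <= n.*2.
Proof.
by case/andP=> /eqP st /allP H hi; apply: H; apply: mem_nth; rewrite st.
Qed.

Lemma word_on_shift n x g r t : block_shape n x g ->
  (forall v, 0 < v <= n.*2 -> (v \notin r) = kept n x g v) ->
  in_range (n - g.+1) t ->
  word_on (interval_minus n r) t = [seq shift n x g i | i <- t].
Proof.
move=> sh Hr /andP[_ /allP Ht]; rewrite (interval_minus_shift sh Hr).
apply/eq_in_map => i /Ht hi.
rewrite (nth_map 0) ?size_iota ?nth_iota; try lia.
by congr shift; lia.
Qed.

(** The common form of the three cases of [Psi_step]: the block, the shifted word [t], then the
    entries forced by symmetry. *)
Definition build (n x g : nat) (t : seq nat) : seq nat :=
  x :: [seq n.*2.+2 - i | i <- iota 2 g] ++ [seq shift n x g i | i <- t]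
    ++ rev (iota 1 g) ++ [:: n.*2.+1 - x].

Lemma size_build n x g t : block_shape n x g -> size t = (n - g.+1).*2 ->
  size (build n x g t) = n.*2.
Proof.
rewrite /build /= !size_cat /= !size_map size_rev !size_iota => + ->.
rewrite /block_shape; lia.
Qed.

Lemma nth_build n x g t l : block_shape n x g -> size t = (n - g.+1).*2 ->
  l < n.*2 ->
  nth 0 (build n x g t) l =
    if l == 0 then x else if l <= g then n.*2.+1 - l
    else if l < n.*2.-1 - g then shift n x g (nth 0 t (l - g.+1))
    else if l < n.*2.-1 then n.*2.-1 - l else n.*2.+1 - x.
Proof.
rewrite /block_shape => sh st; case: l => [//|l] hl; rewrite /build /=.
rewrite nth_cat size_map size_iota; case: ltnP => h1.
  by rewrite (nth_map 0) ?size_iota ?nth_iota; lia.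
rewrite nth_cat size_map st.
case: ifP => h2; case: ifP => h3; try lia.
  by rewrite (nth_map 0) ?st; [congr (shift _ _ _ (nth _ _ _))|]; lia.
rewrite nth_cat size_rev size_iota.
case: ifP => h4; case: ifP => h5; try lia.
  by rewrite nth_rev ?size_iota ?nth_iota; lia.
by have -> : l - g - (n - g.+1).*2 - g = 0 by lia.
Qed.

Lemma nth_build_mid n x g t i : block_shape n x g -> size t = (n - g.+1).*2 ->
  i < (n - g.+1).*2 ->
  nth 0 (build n x g t) (g.+1 + i) = shift n x g (nth 0 t i).
Proof.
move=> sh st hi; rewrite nth_build //; last by lia.
by rewrite addKn ifF ?ifT //; lia.
Qed.

Lemma in_range_build n x g t : block_shape n x g -> in_range (n - g.+1) t ->
  in_range n (build n x g t).
Proof.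
move=> sh rt; have /andP[/eqP st _] := rt.
apply/andP; split; first by rewrite size_build.
apply/(all_nthP 0) => i; rewrite size_build // => hi.
rewrite nth_build //; move: (sh); rewrite /block_shape.
case: ifP => h0; first by lia.
case: ifP => h1; first by lia.
case: ifP => h2; last by case: ifP; lia.
have := @in_range_nth _ _ (i - g.+1) rt.
have := @shift_kept n x g (nth 0 t (i - g.+1)) sh; rewrite /kept; lia.
Qed.

(** * Symmetric 123-avoiding words *)

(** [C123] stated for words, so that an induction can change [n] without transporting
    permutations. *)
Record good (n : nat) (w : seq nat) : Prop := Good {
  good_range : in_range n w;
  good_uniq : uniq w;
  good_sym : forall i, i < n.*2 ->
    nth 0 w i + nth 0 w (n.*2.-1 - i) = n.*2.+1;
  good_avoid : forall i j k, i < j -> j < k -> k < n.*2 ->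
    nth 0 w i < nth 0 w j -> nth 0 w j < nth 0 w k -> False }.

Lemma good_size n w : good n w -> size w = n.*2.
Proof. by case=> /andP[/eqP]. Qed.

Lemma good_bound n w i : good n w -> i < n.*2 -> 0 < nth 0 w i <= n.*2.
Proof. by case=> r _ _ _; apply: in_range_nth. Qed.

Lemma good_inj n w i j : good n w -> i < n.*2 -> j < n.*2 ->
  nth 0 w i = nth 0 w j -> i = j.
Proof.
move=> gw hi hj /eqP; rewrite nth_uniq ?(good_size gw) ?(good_uniq gw) //.
by move/eqP.
Qed.

Lemma good_surj n w v : good n w -> 0 < v <= n.*2 ->
  exists2 i, i < n.*2 & nth 0 w i = v.
Proof.
move=> gw hv; have sub : {subset w <= iota 1 n.*2}.
  move=> u /(nthP 0)[i]; rewrite (good_size gw) => hi <-.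
  by rewrite mem_iota add1n ltnS; apply: good_bound gw hi.
have le : size (iota 1 n.*2) <= size w by rewrite size_iota (good_size gw).
have [_ E] := uniq_min_size (good_uniq gw) sub le.
have : v \in w by rewrite E mem_iota; lia.
by move/(nthP 0)=> [i]; rewrite (good_size gw); exists i.
Qed.

(** The middle of the built word is an increasing image of [t], so 123 patterns lift; symmetry
    descends by [shift_compl] and injectivity. *)
Lemma good_of_build n x g t : block_shape n x g -> in_range (n - g.+1) t ->
  good n (build n x g t) -> good (n - g.+1) t.
Proof.
move=> sh rt gw; have /andP[/eqP st _] := rt.
have E i : i < (n - g.+1).*2 ->
    nth 0 (build n x g t) (g.+1 + i) = shift n x g (nth 0 t i).
  exact: nth_build_mid.
have shb : g < n by case/and3P: sh.
split=> //.
- apply: (@map_uniq _ _ (shift n x g)).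
  have := good_uniq gw; rewrite /build cons_uniq => /andP[_].
  by rewrite cat_uniq => /and3P[_ _]; rewrite cat_uniq => /and3P[].
- move=> i hi; have hi' : (n - g.+1).*2.-1 - i < (n - g.+1).*2 by lia.
  have := @good_sym _ _ gw (g.+1 + i) ltac:(lia).
  have -> : n.*2.-1 - (g.+1 + i) = g.+1 + ((n - g.+1).*2.-1 - i) by lia.
  rewrite !E //.
  have b1 := in_range_nth rt hi; have b2 := in_range_nth rt hi'.
  have := shift_compl sh b1; have := shift_kept sh b1.
  move: b1 b2; set a := nth _ _ _; set b := nth _ _ _ => b1 b2 k1 c1 s1.
  have : shift n x g b = shift n x g ((n - g.+1).*2.+1 - a).
    by rewrite -c1; move: k1; rewrite /kept; lia.
  by move/shift_inj; lia.
- move=> i j k hij hjk hk lij ljk.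
  apply: (@good_avoid _ _ gw (g.+1 + i) (g.+1 + j) (g.+1 + k)); try lia.
    by rewrite !E; try lia; apply: shift_mono.
  by rewrite !E; try lia; apply: shift_mono.
Qed.

(** If the first entry were below [n], the last would exceed [n + 1], and the value [n] between them
    would complete a 123 pattern. *)
Lemma good_head_ge n w : 0 < n -> good n w -> n <= nth 0 w 0.
Proof.
move=> n0 gw; rewrite leqNgt; apply/negP => lt.
have [i hi wi] := @good_surj _ _ n gw ltac:(lia).
have := @good_sym _ _ gw 0 ltac:(lia); rewrite subn0 => sy.
have i0 : i != 0 by apply/eqP => e; move: wi lt; rewrite e; lia.
have il : i != n.*2.-1 by apply/eqP => e; move: wi; rewrite e; lia.
by apply: (@good_avoid _ _ gw 0 i n.*2.-1); lia.
Qed.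

(* If [w_0 < w_i], every larger value not yet seen would complete a 123
   pattern starting with [w_0, w_i]. *)
Lemma good_gap n w g : good n w -> g < n ->
  (forall i, 0 < i <= g -> nth 0 w 0 < nth 0 w i) ->
  forall i, 0 < i <= g -> nth 0 w i = n.*2.+1 - i.
Proof.
move=> gw gn H; elim/ltn_ind => i IH hi.
have [p hp wp] := @good_surj _ _ (n.*2.+1 - i) gw ltac:(lia).
have [v0 vn] := andP (@good_bound _ _ i gw ltac:(lia)).
have [wi|wi|//] := ltngtP (nth 0 w i) (n.*2.+1 - i).
  exfalso; have xi := H i hi.
  have [pi|pi|pi] := ltngtP p i.
  - case: (posnP p) => [p0|p0]; first by move: wp; rewrite p0; lia.
    by have := IH p pi ltac:(lia); lia.
  - by apply: (@good_avoid _ _ gw 0 i p); lia.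
  - by move: wp; rewrite pi; lia.
(* An entry above [2n + 1 - i] is [2n + 1 - q] with [0 < q < i], a value already placed at [q] by
   induction. *)
pose q := n.*2.+1 - nth 0 w i.
have e : nth 0 w q = nth 0 w i by rewrite IH /q; lia.
by have := @good_inj _ _ q i gw ltac:(lia) ltac:(lia) e; lia.
Qed.

Lemma good_decomp n w : 0 < n -> good n w -> exists x g t,
  [/\ block_shape n x g, in_range (n - g.+1) t, w = build n x g t
    & g.+1 < n -> shift n x g (nth 0 t 0) < x].
Proof.
move=> n0 gw; have sw := good_size gw; have xn := good_head_ge n0 gw.
set x := nth 0 w 0 in xn *.
(* The rest of the first half; the gap ends at its first entry below [x], or at the middle of [w] if
   there is none. *)
pose u := take n.-1 (behead w).
have su : size u = n.-1 by rewrite size_takel // size_behead sw; lia.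
have un i : i < n.-1 -> nth 0 u i = nth 0 w i.+1.
  by move=> hi; rewrite nth_take // nth_behead.
pose g := find (fun v => v < x) u.
have gn : g <= n.-1 by rewrite -su find_size.
have gap : forall i, 0 < i <= g -> nth 0 w i = n.*2.+1 - i.
  apply: good_gap => //; first by lia.
  move=> i hi; have := @before_find _ 0 (fun v => v < x) u i.-1 ltac:(lia).
  rewrite un; last by lia.
  rewrite prednK; last by lia.
  move=> h; have := @good_inj _ _ 0 i gw ltac:(lia) ltac:(lia); rewrite -/x; lia.
have lst i : 0 < i <= g -> nth 0 w (n.*2.-1 - i) = i.
  by move=> hi; have := @good_sym _ _ gw i ltac:(lia); rewrite gap; lia.
have wl : nth 0 w n.*2.-1 = n.*2.+1 - x.
  by have := @good_sym _ _ gw 0 ltac:(lia); rewrite subn0 -/x; lia.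
have xg : x + g <= n.*2.
  case: (posnP g) => [g0|g0].
    by have := @good_bound _ _ 0 gw; rewrite -/x; lia.
  have := @before_find _ 0 (fun v => v < x) u g.-1 ltac:(lia).
  rewrite un ?prednK; try lia.
  have := @good_inj _ _ 0 g gw ltac:(lia) ltac:(lia); rewrite -/x.
  by rewrite gap; lia.
have sh : block_shape n x g by rewrite /block_shape; lia.
have kp i : g < i < n.*2.-1 - g -> kept n x g (nth 0 w i).
  move=> hi; have := @good_bound _ _ i gw ltac:(lia) => bi; rewrite /kept.
  apply/and4P; split.
  (* The values [1, ..., g] and [2n + 1 - g, ..., 2n] already occupy the last and first positions,
     so injectivity excludes them here. *)
  - rewrite ltnNge; apply/negP => h.
    by have := @good_inj _ _ i (n.*2.-1 - nth 0 w i) gw; rewrite lst; lia.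
  - rewrite leqNgt; apply/negP => h.
    by have := @good_inj _ _ i (n.*2.+1 - nth 0 w i) gw; rewrite [nth 0 w (_ - _)]gap; lia.
  - by apply/eqP => e; have := @good_inj _ _ i 0 gw; rewrite -/x; lia.
  - by apply/eqP => e; have := @good_inj _ _ i n.*2.-1 gw; lia.
pose t := [seq unshift n x g v | v <- take (n - g.+1).*2 (drop g.+1 w)].
have st : size t = (n - g.+1).*2.
  by rewrite size_map size_takel // size_drop sw; lia.
have tn i : i < (n - g.+1).*2 -> nth 0 t i = unshift n x g (nth 0 w (g.+1 + i)).
  move=> hi; rewrite (nth_map 0) ?nth_take ?nth_drop //.
  by rewrite -(size_map (unshift n x g)) -/t st.
exists x, g, t; split=> //.
- rewrite /in_range st eqxx; apply/(all_nthP 0) => i; rewrite st => hi.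
  by rewrite tn //; apply: (unshiftK sh _).2; apply: kp; lia.
- apply: (@eq_from_nth _ 0); first by rewrite size_build.
  move=> i; rewrite sw => hi; rewrite nth_build //.
  case: eqP => [->//|i0]; case: ifP => h1; first by apply: gap; lia.
  case: ifP => h2.
    rewrite tn; last by lia.
    rewrite subnKC; last by lia.
    by rewrite (unshiftK sh _).1 //; apply: kp; lia.
  case: ifP => h3; last by rewrite -wl; congr nth; lia.
  by have := lst (n.*2.-1 - i) ltac:(lia); rewrite subKn; lia.
- move=> gn'; rewrite tn; last by lia.
  rewrite (unshiftK sh _).1; last by apply: kp; lia.
  have : has (fun v => v < x) u by rewrite has_find su -/g; lia.
  by move/(nth_find 0); rewrite -/g un ?addn0; lia.
Qed.

(** * Tiny minima of words *)

(** Membership in a set [A_i], indexed by the position [l] of the next minimum instead of by [i]. *)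
Definition unused (n : nat) (w : seq nat) (l v : nat) : bool :=
  (v \notin take l w) && (v \notin [seq n.*2.+1 - a | a <- take l w]).

(* The unused values are symmetric about [n + 1/2], so their lower median is
   the largest unused value that is at most [n]. *)
Definition tiny_at (n : nat) (w : seq nat) (l : nat) : bool :=
  [&& ltr_min w l, nth 0 w l <= n &
      all (fun v => ~~ unused n w l v) (iota (nth 0 w l).+1 (n - nth 0 w l))].

Definition tiny_count (n : nat) (w : seq nat) : nat :=
  count (tiny_at n w) (iota 0 n).

Lemma ltr_minP w l :
  reflect (forall j, j <= l -> nth 0 w l <= nth 0 w j) (ltr_min w l).
Proof.
apply: (iffP allP) => H j; first by move=> hj; apply: H; rewrite mem_iota.
by rewrite mem_iota add0n ltnS /= => /H.
Qed.

Lemma usedP n w l v : good n w -> l <= n.*2 -> 0 < v <= n.*2 ->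
  reflect (exists2 i, i < l & nth 0 w i = v \/ nth 0 w i = n.*2.+1 - v)
    (~~ unused n w l v).
Proof.
move=> gw hl hv; have sl : size (take l w) = l.
  by rewrite size_takel // (good_size gw).
rewrite /unused negb_and !negbK; apply: (iffP orP).
- case=> [/(nthP 0)[i]|/mapP[a /(nthP 0)[i]]]; rewrite sl => hi;
    rewrite nth_take // => e; first by exists i; [|left].
  move=> va; exists i => //; right.
  by have := @good_bound _ _ i gw ltac:(lia); rewrite e; lia.
- case=> i hi; rewrite -(nth_take 0 hi) => e.
  have mi : nth 0 (take l w) i \in take l w by rewrite mem_nth ?sl.
  case: e => e; first by left; rewrite -e.
  right; apply/mapP; exists (nth 0 (take l w) i) => //; rewrite e; lia.
Qed.

Lemma tiny_atP n w l : good n w -> l < n ->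
  reflect [/\ forall j, j <= l -> nth 0 w l <= nth 0 w j, nth 0 w l <= n
    & forall v, nth 0 w l < v <= n ->
      exists2 i, i < l & nth 0 w i = v \/ nth 0 w i = n.*2.+1 - v]
    (tiny_at n w l).
Proof.
move=> gw hl; apply: (iffP and3P) => [[/ltr_minP H1 H2 /allP H3]|[H1 H2 H3]].
  split=> // v hv; apply/(usedP gw); try lia.
  by apply: H3; rewrite mem_iota; lia.
split=> //; first exact/ltr_minP.
apply/allP => v; rewrite mem_iota => hv; apply/(usedP gw); try lia.
by apply: H3; lia.
Qed.

(** Position 0 contributes [x == n], the gap contributes nothing, and the later positions of the
    first half match those of [t]. The last hypothesis makes minima of [t] remain minima after
    [x]. *)
Lemma tiny_count_build n x g t :
  block_shape n x g -> good (n - g.+1) t -> good n (build n x g t) ->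
  (g.+1 < n -> shift n x g (nth 0 t 0) < x) ->
  tiny_count n (build n x g t) = (x == n) + tiny_count (n - g.+1) t.
Proof.
move=> sh gt gw hx; set w := build n x g t in gw *.
have [gn xn xg] := and3P sh; have st := good_size gt.
have w0 : nth 0 w 0 = x by [].
have wg j : 0 < j <= g -> nth 0 w j = n.*2.+1 - j.
  move=> hj; rewrite nth_build //; last by lia.
  by rewrite ifF ?ifT; lia.
have wm j : j < (n - g.+1).*2 -> nth 0 w (g.+1 + j) = shift n x g (nth 0 t j).
  exact: nth_build_mid.
have tb j : j < (n - g.+1).*2 -> 0 < nth 0 t j <= (n - g.+1).*2.
  exact: good_bound.
have -> : tiny_count n w =
    count (tiny_at n w) (iota 0 1 ++ iota 1 g ++ iota g.+1 (n - g.+1)).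
  rewrite /tiny_count; congr count; rewrite -{1}[g.+1]add1n -iotaD -(iotaD 0 1).
  by congr iota; lia.
rewrite !count_cat.
(* Nothing is used before position 0, so [x] is tiny exactly when no value lies in [(x, n]] and
   [x <= n]. *)
congr (_ + _).
  rewrite /= addn0; congr nat_of_bool; apply/tiny_atP/eqP => //; try lia.
    by case=> _ + _; rewrite w0; lia.
  move=> e; split; rewrite ?w0 ?e //; last by lia.
  by case.
rewrite (eq_in_count (a2 := pred0)) ?count_pred0 ?add0n; last first.
  move=> l; rewrite mem_iota => hl; apply/negP => /tiny_atP [] //; try lia.
  by move=> /(_ 0 isT) + _ _; rewrite w0 wg; lia.
rewrite -{1}[g.+1]addn0 iotaDl count_map.
apply: eq_in_count => i; rewrite mem_iota add0n /= => hi.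
have hi2 : i < (n - g.+1).*2 by lia.
apply/tiny_atP/tiny_atP => //; try lia; rewrite wm // => -[H1 H2 H3].
- split.
  + move=> j hj; have := H1 (g.+1 + j) ltac:(lia).
    by rewrite wm ?shift_le; lia.
  + by rewrite -(shift_le_half sh (tb _ hi2)).
  move=> v hv; have bv : 0 < v <= (n - g.+1).*2 by lia.
  have kv := shift_kept sh bv; have := shift_compl sh bv => cv.
  have bv' : 0 < (n - g.+1).*2.+1 - v <= (n - g.+1).*2 by lia.
  have kv' := shift_kept sh bv'.
  have [|a ha ea] := H3 (shift n x g v).
    by rewrite (shift_le_half sh bv) shift_mono; lia.
  (* The value and its complement are both kept, so the position using one of them lies outside the
     block. *)
  have ag : g < a.
    rewrite ltnNge; apply/negP => lag; move: ea kv kv'; rewrite -cv /kept.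
    by case: (posnP a) => [->|a0]; rewrite ?w0 ?wg; lia.
  exists (a - g.+1); first by lia.
  have := wm (a - g.+1) ltac:(lia); rewrite subnKC // => ea'.
  case: ea; rewrite ea' => /eqP.
    by rewrite (inj_eq (@shift_inj n x g)) => /eqP; left.
  by rewrite cv (inj_eq (@shift_inj n x g)) => /eqP; right.
- split.
  + move=> j hj; case: (posnP j) => [->|j0].
      rewrite w0; apply: ltnW; apply: leq_ltn_trans (hx ltac:(lia)).
      by rewrite shift_le; apply: H1.
    have [jg|jg] := leqP j g.
      rewrite wg; last by lia.
      have := hx ltac:(lia); have := H1 0 isT.
      by rewrite -(shift_le n x g); lia.
    have := wm (j - g.+1) ltac:(lia); rewrite subnKC // => ->.
    by rewrite shift_le; apply: H1; lia.
  + by rewrite (shift_le_half sh (tb _ hi2)).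
  move=> v hv; have := shift_kept sh (tb _ hi2) => ki.
  (* Since [g < v <= n], a deleted [v] can only be [x] or its complement, and position 0 uses
     both. *)
  have [kv|nkv] := boolP (kept n x g v); last first.
    exists 0; rewrite ?w0 //; move: ki nkv; rewrite /kept.
    by case: (v =P x) => ?; [left|right]; lia.
  have [e bv] := unshiftK sh kv.
  have [|a ha ea] := H3 (unshift n x g v).
    move: hv; rewrite -{1 2}e (shift_le_half sh bv) => /andP[h ->].
    by rewrite andbT ltnNge -(shift_le n x g) -ltnNge.
  exists (g.+1 + a); first by lia.
  rewrite wm; last by lia.
  case: ea => ->; rewrite ?e; first by left.
  by rewrite -(shift_compl sh bv) e; right.
Qed.

(** * Lower medians of symmetric sets *)

Lemma rev_iota1 m : rev (iota 1 m) = [seq m.+1 - i | i <- iota 1 m].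
Proof.
apply: (@eq_from_nth _ 0); first by rewrite size_rev size_map.
move=> i; rewrite size_rev size_iota => hi.
by rewrite nth_rev ?size_iota // (nth_map 0) ?size_iota ?nth_iota; lia.
Qed.

(** By symmetry the selected values split into equal parts [L] below and [U] above the middle, so
    the lower median is the last element of [L]. *)
Lemma lower_medianE n (P : pred nat) v : 0 < v <= n.*2 -> P v ->
  (forall u, 0 < u <= n.*2 -> P (n.*2.+1 - u) = P u) ->
  (v == lower_median [seq u <- iota 1 n.*2 | P u]) =
  (v <= n) && all (fun u => ~~ P u) (iota v.+1 (n - v)).
Proof.
move=> hv Pv sym; pose L := [seq u <- iota 1 n | P u].
pose U := [seq u <- iota n.+1 n | P u].
have E : [seq u <- iota 1 n.*2 | P u] = L ++ U.
  by rewrite -addnn iotaD filter_cat add1n.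
have mL u : (u \in L) = (0 < u <= n) && P u.
  by rewrite mem_filter mem_iota add1n ltnS andbC.
have sU : size U = size L.
  rewrite /U.
  have -> : iota n.+1 n = [seq n.*2.+1 - u | u <- rev (iota 1 n)].
    rewrite rev_iota1 -map_comp -[n.+1]addn1 iotaDl.
    by apply/eq_in_map => u; rewrite mem_iota /=; lia.
  rewrite filter_map size_map filter_rev size_rev; congr size.
  by apply: eq_in_filter => u; rewrite mem_iota /= => hu; apply: sym; lia.
have vL : (v \in L) || (n.*2.+1 - v \in L).
  by rewrite !mL (sym _ hv) Pv; lia.
have L0 : L != [::] by case: (L) vL.
have -> : lower_median [seq u <- iota 1 n.*2 | P u] = last 0 L.
  rewrite /lower_median E size_cat sU addnn doubleK nth_cat.
  by case: (L) L0 => //= a l _; rewrite ltnS leqnn -last_nth.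
have lastL : last 0 L \in L by case: (L) L0 => //= a l _; apply: mem_last.
have lastM u : u \in L -> u <= last 0 L.
  move=> uL; have : sorted leq L.
    by apply: sorted_filter; [apply: leq_trans | apply: iota_sorted].
  move=> /(sorted_leq_nth leq_trans leqnn 0) H.
  have /(nthP 0)[i hi <-] := uL; rewrite -nth_last; apply: H.
  - by rewrite inE.
  - by rewrite inE (ltn_predK hi).
  - by rewrite -ltnS (ltn_predK hi).
apply/eqP/andP => [e|[vn /allP H]].
- move: lastL; rewrite mL -e => /andP[vn _]; split; first by lia.
  apply/allP => u; rewrite mem_iota => hu; apply/negP => Pu.
  by have := lastM u; rewrite mL Pu -e; lia.
- have := lastM v; rewrite mL Pv vn => /(_ ltac:(lia)).
  rewrite leq_eqVlt => /orP[/eqP//|lt].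
  move: lastL; rewrite mL => /andP[b Pl].
  by have := H (last 0 L); rewrite Pl mem_iota; lia.
Qed.

(** * Tiny minima of permutations *)

Lemma size_one_line m (s : 'S_m) : size (one_line s) = m.
Proof. by rewrite size_map size_enum_ord. Qed.

Lemma nth_one_line m (s : 'S_m) (i : 'I_m) : nth 0 (one_line s) i = (s i).+1.
Proof. by rewrite (nth_map i) ?size_enum_ord // nth_ord_enum. Qed.

Lemma good_one_line n (s : 'S_(n.*2)) : s \in C123 n -> good n (one_line s).
Proof.
rewrite inE => /andP[/forallP sym av]; split.
- rewrite /in_range size_one_line eqxx; apply/allP => v /mapP[i _ ->].
  by rewrite ltn0Sn ltn_ord.
- rewrite map_inj_uniq ?enum_uniq // => i j [e].
  by apply: (@perm_inj _ s); apply: val_inj.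
- move=> i hi; have := sym (Ordinal hi); rewrite -!nth_one_line /= => /eqP <-.
  by congr (_ + nth _ _ _); lia.
- move=> i j k hij hjk hk.
  have hj := ltn_trans hjk hk; have hi := ltn_trans hij hj.
  have := nth_one_line s (Ordinal hi) => /= ->.
  have := nth_one_line s (Ordinal hj) => /= ->.
  have := nth_one_line s (Ordinal hk) => /= ->.
  rewrite !ltnS => lij ljk; move/negP: av; apply.
  apply/existsP; exists (Ordinal hi); apply/existsP; exists (Ordinal hj).
  by apply/existsP; exists (Ordinal hk); rewrite hij hjk lij ljk.
Qed.

Section MinPositions.
Variables (n : nat) (s : 'S_(n.*2)).
Let w := one_line s.
Let mp := min_positions s.

Lemma nth_half_word l : l < n -> nth 0 (half_word s) l = nth 0 w l.
Proof. by move=> hl; rewrite nth_take. Qed.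

Lemma ltr_min_half_word l : l < n -> ltr_min (half_word s) l = ltr_min w l.
Proof.
move=> hl; apply: eq_in_all => j; rewrite mem_iota => hj.
by rewrite !nth_half_word //; lia.
Qed.

Lemma min_position_lt i : i < size mp -> nth n mp i < n.
Proof. by move/(mem_nth n); rewrite mem_filter mem_iota => /and3P[]. Qed.

Lemma min_position_mono i : i < size mp -> nth n mp i < nth n mp i.+1 <= n.
Proof.
move=> hi; have := min_position_lt hi.
(* Past the last minimum the default [n] of [nth] serves as the end of the half word. *)
have [h|h] := ltnP i.+1 (size mp); last by rewrite [nth n mp i.+1]nth_default; lia.
rewrite (ltnW (min_position_lt h)) andbT => _.
have srt : sorted ltn mp.
  by apply: sorted_filter; [apply: ltn_trans | apply: iota_ltn_sorted].
by apply: (sorted_ltn_nth ltn_trans n srt).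
Qed.

Lemma min_position0 : nth n mp 0 = 0.
Proof.
have : ltr_min (half_word s) 0 by rewrite /ltr_min /= leqnn.
by rewrite /mp /min_positions; move: (ltr_min _) => f; case: (n) => //= m ->.
Qed.

Lemma mem_take_min_position i : i < size mp ->
  take (nth n mp i.+1) w =i
  take (nth n mp i) w ++ min_value s i :: gap_word s i.
Proof.
move=> hi u; have := min_position_mono hi; have := min_position_lt hi.
rewrite /min_value /gap_word -/mp; set a := nth n mp i; set b := nth n mp i.+1.
move=> an /andP[ab bn].
have sz l : l <= n -> size (take l w) = l.
  by move=> hl; rewrite size_takel // size_one_line; lia.
apply/(nthP 0)/idP.
- case=> l; rewrite sz // => lb; rewrite nth_take // => <-.
  rewrite mem_cat inE; have [la|al|->] := ltngtP l a.
  + by apply/orP; left; apply/(nthP 0); exists l; rewrite ?sz ?nth_take //; lia.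
  + rewrite orbA; apply/orP; right; apply/mapP; exists l.
      by rewrite mem_filter al lb mem_iota; lia.
    by rewrite nth_half_word //; lia.
  + by rewrite nth_half_word // eqxx orbT.
- rewrite mem_cat inE => /or3P[/(nthP 0)[l]|/eqP->|/mapP[l]].
  + rewrite sz ?(ltnW an) // => la; rewrite nth_take // => <-.
    by exists l; rewrite ?sz ?nth_take //; lia.
  + by exists a; rewrite ?sz ?nth_take ?nth_half_word.
  + rewrite mem_filter => /andP[/andP[al lb] _] ->; exists l; rewrite ?sz //.
    by rewrite nth_take // nth_half_word //; lia.
Qed.

(** By [mem_take_min_position], removing [x_i], [w_i] and their complements extends the used prefix
    to the next minimum. *)
Lemma remainingE i : i <= size mp ->
  remaining s i = [seq v <- iota 1 n.*2 | unused n w (nth n mp i) v].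
Proof.
elim: i => [_|i IH hi].
  by rewrite min_position0 -[LHS]filter_predT; apply: eq_filter => v;
    rewrite /unused take0.
have := mem_take_min_position hi.
have -> : remaining s i.+1 = let b := min_value s i :: gap_word s i in
  [seq v <- remaining s i |
     (v \notin b) && (v \notin [seq n.*2.+1 - a | a <- b])] by [].
move: (_ :: _) => b M; rewrite /= IH ?(ltnW hi) // -filter_predI.
apply: eq_filter => v; rewrite [LHS]/=.
rewrite /unused M (eq_mem_map _ M) map_cat !mem_cat !negb_or.
by rewrite [RHS]andbACA [LHS]andbC.
Qed.

Lemma num_tiny_minimaE : good n w -> num_tiny_minima s = tiny_count n w.
Proof.
move=> gw; rewrite /num_tiny_minima /num_minima -/mp.
pose tq l := nth 0 w l == lower_median [seq v <- iota 1 n.*2 | unused n w l v].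
have -> : count (tiny s) (iota 0 (size mp)) = count tq mp.
  rewrite -[in RHS](mkseq_nth n mp) count_map; apply: eq_in_count => i.
  rewrite mem_iota add0n => hi; rewrite /tiny remainingE ?(ltnW hi) //.
  by rewrite /min_value -/mp nth_half_word ?min_position_lt.
rewrite count_filter; apply: eq_in_count => l; rewrite mem_iota add0n => hl /=.
rewrite ltr_min_half_word // /tiny_at andbC; congr (_ && _).
apply: lower_medianE.
- by apply: good_bound gw _; lia.
- apply: contraT => /(usedP gw) []; try lia; first by apply: good_bound gw _; lia.
  move=> i il [/(good_inj gw)|e]; first by lia.
  have := @good_sym _ _ gw l ltac:(lia) => e'.
  have : nth 0 w (n.*2.-1 - l) = nth 0 w i by lia.
  by move/(good_inj gw); lia.
- move=> u hu; apply: negb_inj.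
  apply/(usedP gw)/(usedP gw); try lia.
    by case=> i hi h; exists i => //; case: h => ->; [right|left]; lia.
  by case=> i hi h; exists i => //; case: h => ->; [right|left]; lia.
Qed.

End MinPositions.

(** * Dyck prefixes *)

(** The Dyck condition from starting height [h], suited to induction on the word. *)
Fixpoint dyck_from (h : nat) (p : seq bool) : bool :=
  if p is u :: p' then
    if u then dyck_from h.+1 p' else (0 < h) && dyck_from h.-1 p'
  else true.

Lemma height_cons u p : (height (u :: p) = (if u then 1 else -1) + height p)%R.
Proof. by rewrite /height big_cons. Qed.

Lemma height_cat p q : (height (p ++ q) = height p + height q)%R.
Proof. by rewrite /height big_cat. Qed.

Lemma height_nil : height [::] = 0%R.
Proof. by rewrite /height big_nil. Qed.

Lemma height_nseqU j : height (nseq j true) = Posz j.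
Proof. by elim: j => [|j IH]; rewrite ?height_nil //= height_cons IH; lia. Qed.

Lemma height_nseqD k : height (nseq k false) = (- Posz k)%R.
Proof. by elim: k => [|k IH]; rewrite ?height_nil //= height_cons IH; lia. Qed.

Lemma dyck_prefixE p : dyck_prefix p = dyck_from 0 p.
Proof.
suff H h q : all (fun i => (0 <= Posz h + height (take i q))%R)
    (iota 0 (size q).+1) = dyck_from h q.
  by rewrite -H; apply: eq_all => i; rewrite GRing.add0r.
elim: q h => [|u q IH] h; first by rewrite /= height_nil; lia.
have -> : iota 0 (size (u :: q)).+1 =
    [:: 0] ++ [seq i.+1 | i <- iota 0 (size q).+1].
  by rewrite -(eq_map add1n) -iotaDl.
rewrite all_cat all_seq1 take0 height_nil all_map.
have -> : (0 <= Posz h + 0)%R by lia.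
rewrite andTb; case: u.
  by rewrite [RHS]/= -IH; apply: eq_all => i /=; rewrite height_cons; lia.
case: h => [|h]; first by rewrite /= take0 height_cons height_nil; lia.
rewrite [RHS]/=.
by rewrite -IH; apply: eq_all => i /=; rewrite height_cons; lia.
Qed.

Lemma dyck_fromU h j p : dyck_from h (nseq j true ++ p) = dyck_from (h + j) p.
Proof. by elim: j h => [|j IH] h /=; rewrite ?addn0 // IH addSnnS. Qed.

Lemma dyck_fromD h k p :
  dyck_from h (nseq k false ++ p) = (k <= h) && dyck_from (h - k) p.
Proof.
elim: k h => [|k IH] h /=; first by rewrite subn0.
by rewrite IH; case: h => [|h] //=.
Qed.

Lemma dyck_from_large h p : size p <= h -> dyck_from h p.
Proof.
elim: p h => [//|[] p IH] h /= hp; first by apply: IH; lia.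
by rewrite IH; lia.
Qed.

(** * Decomposition into maximal runs *)

Lemma take_findU p a : a <= find negb p -> p = nseq a true ++ drop a p.
Proof.
elim: a p => [|a IH] p; first by rewrite drop0.
by case: p => [//|[] p] //= h; rewrite -IH.
Qed.

Lemma take_findD p : p = nseq (find id p) false ++ drop (find id p) p.
Proof. by elim: p => [//|[] p IH] //=; rewrite -IH. Qed.

Lemma head_drop_findU p a : a < find negb p -> head true (drop a p).
Proof.
move=> h; rewrite -nth0 nth_drop addn0.
by have := before_find true h; case: nth.
Qed.

Lemma find_nseqU a p : find negb (nseq a true ++ p) = a + find negb p.
Proof. by elim: a => [|a IH] //=; rewrite IH. Qed.

Lemma find_head_true p : head true p -> 0 < size p -> 0 < find negb p.
Proof. by case: p => [//|[] p]. Qed.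

Lemma find_decomp j k r : (0 < k) || nilp r ->
  find negb (nseq j true ++ nseq k false ++ r) = j.
Proof.
move=> hk; rewrite find_nseqU; case: k hk => [|k] /=; last by rewrite addn0.
by move/nilP ->; rewrite addn0.
Qed.

Lemma dyck_decomp p : exists j k r,
  [/\ p = nseq j true ++ nseq k false ++ r, head true r & (0 < k) || nilp r].
Proof.
pose j := find negb p; pose k := find id (drop j p).
exists j, k, (drop k (drop j p)); split.
- by rewrite -take_findD -take_findU.
- have [h|h] := ltnP k (size (drop j p)); last by rewrite drop_oversize.
  rewrite -nth0 nth_drop addn0.
  by apply: (nth_find true (a := id)); rewrite has_find.
- have [h|h] := ltnP j (size p).
    have : has negb p by rewrite has_find.
    move/(nth_find true); rewrite -/j => Hn.
    by rewrite /k (drop_nth true h) /=; case: nth Hn.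
  by rewrite /nilp !size_drop; lia.
Qed.

(** * The recursion for Psi *)

Section PsiDecomp.
Variables (n j k : nat) (r : seq bool).
Let p := nseq j true ++ nseq k false ++ r.
Hypotheses (n0 : 0 < n) (hr : head true r) (hk : (0 < k) || nilp r).
Hypothesis sp : j + k + size r = n.*2.

Lemma Psi_decomp : Psi p =
  if j <= n then
    (n.*2.+1 - j) :: [seq n.*2.+2 - i | i <- iota 2 k.-1]
    ++ word_on
         (interval_minus n
            (iota 1 k.-1 ++ [:: j; n.*2.+1 - j] ++ iota (n.*2.+2 - k) k.-1))
         (Psi (nseq (j - k) true ++ r))
    ++ rev (iota 1 k.-1) ++ [:: j]
  else if j == n.+1 then
    n :: [seq n.*2.+2 - i | i <- iota 2 k]
    ++ word_on
         (interval_minus n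
            (iota 1 k ++ [:: n; n.+1] ++ iota (n.*2.+1 - k) k))
         (Psi (nseq (n - k.+1) true ++ r))
    ++ rev (iota 1 k) ++ [:: n.+1]
  else
    n :: word_on (interval_minus n [:: n; n.+1])
                 (Psi (nseq (j - 2) true ++ nseq k false ++ r))
    ++ [:: n.+1].
Proof.
have szp : size p = n.*2 by rewrite !size_cat !size_nseq; lia.
have fj : find negb p = j := find_decomp j hk.
have dj : drop j p = nseq k false ++ r by rewrite drop_size_cat ?size_nseq.
have fk : find id (drop j p) = k.
  rewrite dj; elim: (k) => [|k' IH] /=; last by rewrite IH.
  by case: (r) hr => //= u r' ->.
have dr : drop (j + k) p = r.
  by rewrite addnC -drop_drop dj drop_size_cat ?size_nseq.
rewrite PsiE /Psi_step; case: p szp fj fk dr {dj} => [|u p0]; first by move=> /=; lia.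
by move=> -> -> -> ->; rewrite doubleK.
Qed.

End PsiDecomp.

(** The first entry is [2n + 1 - j] for [j <= n] and [n] otherwise; the maximum merges both
    cases. *)
Lemma head_Psi n p : 0 < n -> size p = n.*2 ->
  nth 0 (Psi p) 0 = maxn n (n.*2.+1 - find negb p).
Proof.
move=> n0; have [j [k [r [-> hr hk]]]] := dyck_decomp p.
rewrite !size_cat !size_nseq addnA => sp; rewrite (Psi_decomp n0) // find_decomp //.
by case: ifP => h; [|case: ifP => h'] => /=; lia.
Qed.

(* [Psi_rec n x g q p]: the word [p], of length [2n], is sent by one step of
   the recursion to a permutation that begins with [x, 2n, ..., 2n + 1 - g],
   and the recursive call is on [q]. *)
Inductive Psi_rec (n : nat) : nat -> nat -> seq bool -> seq bool -> Prop :=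
| PsiRecA j k r of 0 < k <= j & j <= n & head true r & j + k + size r = n.*2 :
    Psi_rec n (n.*2.+1 - j) k.-1 (nseq (j - k) true ++ r)
      (nseq j true ++ nseq k false ++ r)
| PsiRecB k r of head true r & (0 < k) || nilp r & k + size r = n.-1 & 0 < n :
    Psi_rec n n k (nseq (n - k.+1) true ++ r)
      (nseq n.+1 true ++ nseq k false ++ r)
| PsiRecC q of n <= find negb q & size q = n.-1.*2 & 0 < n :
    Psi_rec n n 0 q [:: true, true & q].

Lemma Psi_rec_exists n p : 0 < n -> size p = n.*2 -> dyck_from 0 p ->
  exists x g q, Psi_rec n x g q p.
Proof.
move=> n0; have [j [k [r [-> hr hk]]]] := dyck_decomp p.
rewrite !size_cat !size_nseq addnA dyck_fromU dyck_fromD => sp /andP[kj _].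
have [jn|nj] := leqP j n.
  have k0 : 0 < k.
    (* With [k = 0] the word would be [U^(2n)], contradicting [j <= n]. *)
    rewrite lt0n; apply/eqP => k0; move: hk sp.
    by rewrite k0 /nilp /= => /eqP ->; lia.
  by do 3!eexists; apply: PsiRecA => //; lia.
have [e|ne] := eqVneq j n.+1.
  by rewrite e; do 3!eexists; apply: PsiRecB => //; lia.
have -> : j = (j - 2).+2 by lia.
exists n, 0, (nseq (j - 2) true ++ nseq k false ++ r).
apply: PsiRecC => //; first by rewrite find_nseqU; lia.
by rewrite !size_cat !size_nseq; lia.
Qed.

Lemma Psi_rec_shape n x g q p : Psi_rec n x g q p ->
  [/\ block_shape n x g, size q = (n - g.+1).*2 & size p = n.*2].
Proof.
case=> [j k r hk hj hr sp|k r hr hk sp n0|q' hf sq n0];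
  rewrite /block_shape /= ?size_cat ?size_nseq; split; lia.
Qed.

(** In the first case both words reach height [j - k] before [r]. In the others the initial run is
    so high that the remaining letters cannot lead below the axis. *)
Lemma Psi_rec_dyck n x g q p : Psi_rec n x g q p ->
  dyck_from 0 p = dyck_from 0 q.
Proof.
case=> [j k r hk hj hr sp|k r hr hk sp n0|q' hf sq n0].
- by rewrite !dyck_fromU dyck_fromD !add0n (andP hk).2.
- by rewrite !dyck_fromU dyck_fromD !dyck_from_large; lia.
- have e := take_findU hf; have := size_drop n q'; rewrite sq => sd.
  by rewrite /= e !dyck_fromU !dyck_from_large; lia.
Qed.

Lemma Psi_rec_height n x g q p : Psi_rec n x g q p ->
  (height p = height q + Posz (2 * (x == n)))%R.
Proof.
case=> [j k r hk hj hr sp|k r hr hk sp n0|q' hf sq n0].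
- by rewrite !height_cat !height_nseqU height_nseqD; lia.
- by rewrite !height_cat !height_nseqU height_nseqD; lia.
- by rewrite !height_cons; lia.
Qed.

Lemma Psi_rec_build n x g q p : Psi_rec n x g q p ->
  in_range (n - g.+1) (Psi q) -> Psi p = build n x g (Psi q).
Proof.
move=> H; have [sh sq sp] := Psi_rec_shape H; move: H sh sq sp.
case=> [j k r hk hj hr sp|k r hr hk sp n0|q' hf sq n0] sh _ _ rg.
- rewrite (@Psi_decomp n) //; try lia.
  rewrite hj (word_on_shift sh) // /build.
    by congr (_ :: _ ++ _ ++ _ ++ [:: _]); lia.
  by move=> v hv; rewrite !mem_cat !inE !mem_iota /kept; lia.
- rewrite (@Psi_decomp n) //; try lia.
  rewrite ltnn eqxx (word_on_shift sh) // /build.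
    by congr (_ :: _ ++ _ ++ _ ++ [:: _]); lia.
  by move=> v hv; rewrite !mem_cat !inE !mem_iota /kept; lia.
(* The runs of [q'] give those of the full word, whose first run has length [j + 2 >= n + 2]. *)
- have [j [k [r [e hr hk]]]] := dyck_decomp q'.
  have ej : find negb q' = j by rewrite e find_decomp.
  have -> : [:: true, true & q'] = nseq j.+2 true ++ nseq k false ++ r.
    by rewrite /= -e.
  move: sq; rewrite e !size_cat !size_nseq => sq.
  rewrite (@Psi_decomp n) //; try lia.
  rewrite ifF ?ifF; try lia.
  rewrite subn2 /= -e (word_on_shift sh) // /build.
    by congr (_ :: _ ++ [:: _]); lia.
  by move=> v hv; rewrite !inE /kept; lia.
Qed.

(** When [g + 1 < n], the leading run of [q] is long enough that [head_Psi] gives a first entry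
    which shifts below [x]. *)
Lemma Psi_rec_head n x g q p : Psi_rec n x g q p ->
  g.+1 < n -> shift n x g (nth 0 (Psi q) 0) < x.
Proof.
move=> H; have [sh sq sp] := Psi_rec_shape H; move=> gn.
rewrite (@head_Psi (n - g.+1)) //; last by lia.
case: H sh sq sp gn => [j k r hk hj hr sp|k r hr hk sp n0|q' hf sq n0] sh _ _ gn.
- have := find_head_true hr; rewrite find_nseqU.
  by move: sh; rewrite /block_shape /shift; lia.
- have := find_head_true hr; rewrite find_nseqU.
  by move: sh; rewrite /block_shape /shift; lia.
- by move: sh; rewrite /block_shape /shift; lia.
Qed.

(** A converse to [Psi_rec_head]: the bound on the first entry forces enough leading U in [q] to
    recover the preceding word. *)
Lemma Psi_rec_total n x g q : block_shape n x g -> size q = (n - g.+1).*2 ->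
  (g.+1 < n -> shift n x g (nth 0 (Psi q) 0) < x) ->
  exists p, Psi_rec n x g q p.
Proof.
move=> sh sq hx; have [gn xn xg] := and3P sh.
have fq : g.+1 < n -> (if x == n then n - g.+1 else n.*2 - x - g) < find negb q.
  move=> gn'; move: (hx gn'); rewrite (@head_Psi (n - g.+1)) //; last by lia.
  by move: sh; rewrite /block_shape /shift; case: eqP; lia.
have q0 : g.+1 = n -> q = [::] by move=> e; apply/nilP; rewrite /nilp; lia.
have [e|ne] := eqVneq x n; last first.
  (* Case (a) has [x = 2n + 1 - j] and [g = k - 1], so [j - k] leading letters are split off. *)
  pose j := n.*2.+1 - x.
  have Eq : q = nseq (j - g.+1) true ++ drop (j - g.+1) q.
    have [gn'|ng] := ltnP g.+1 n.
      by apply: take_findU; move: (fq gn'); rewrite (negPf ne) /j; lia.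
    have -> : j - g.+1 = 0 by rewrite /j; lia.
    by rewrite drop0.
  have Hr : head true (drop (j - g.+1) q).
    have [gn'|ng] := ltnP g.+1 n; last by rewrite q0 //; lia.
    by apply: head_drop_findU; move: (fq gn'); rewrite (negPf ne) /j; lia.
  exists (nseq j true ++ nseq g.+1 false ++ drop (j - g.+1) q).
  have -> : x = n.*2.+1 - j by rewrite /j; lia.
  rewrite [X in Psi_rec _ _ _ X _]Eq; apply: (@PsiRecA n j g.+1) => //.
  - by rewrite /j; lia.
  - by rewrite /j; lia.
  - by rewrite size_drop sq /j; lia.
move: fq; rewrite e eqxx => fq.
case: (posnP g) => [g0|g0].
  (* With [x = n] and [g = 0] the word is in case (c), except that for [n = 1] it is [UU], case (b)
     with [k = 0]. *)
  have [n1|n1] := leqP n 1.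
    have En : n = 1 by lia.
    rewrite q0 g0 ?En //; exists [:: true; true].
    by apply: (@PsiRecB 1 0 [::]).
  exists [:: true, true & q]; rewrite g0.
  by apply: PsiRecC; [have := fq ltac:(lia)|rewrite sq|]; lia.
exists (nseq n.+1 true ++ nseq g false ++ drop (n - g.+1) q).
have Eq : q = nseq (n - g.+1) true ++ drop (n - g.+1) q.
  have [gn'|ng] := ltnP g.+1 n; first by apply: take_findU; have := fq gn'; lia.
  have -> : n - g.+1 = 0 by lia.
  by rewrite drop0.
rewrite [X in Psi_rec _ _ _ X _]Eq; apply: PsiRecB => //.
- have [gn'|ng] := ltnP g.+1 n; last by rewrite q0 //; lia.
  by apply: head_drop_findU; have := fq gn'; lia.
- by rewrite g0.
- by rewrite size_drop sq; lia.
- by lia.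
Qed.

(** * Surjectivity and the final height *)

Lemma Psi_in_range n p : size p = n.*2 -> dyck_from 0 p -> in_range n (Psi p).
Proof.
elim/ltn_ind: n p => n IH p sp dp; case: (posnP n) => [n0|n0].
  by move: sp; rewrite n0 => /size0nil ->.
have [x [g [q H]]] := Psi_rec_exists n0 sp dp.
have [sh sq _] := Psi_rec_shape H.
have rq : in_range (n - g.+1) (Psi q).
  by apply: IH; rewrite -?(Psi_rec_dyck H) //; lia.
by rewrite (Psi_rec_build H rq); apply: in_range_build.
Qed.

(** Induction on [n]: remove the first block, take a preimage of the smaller word, and lift it by
    [Psi_rec_total]. *)
Lemma Psi_surj n w : good n w ->
  exists p, [/\ size p = n.*2, dyck_from 0 p & Psi p = w].
Proof.
elim/ltn_ind: n w => n IH w gw; case: (posnP n) => [n0|n0].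
  exists [::]; split; rewrite ?n0 //; symmetry; apply: size0nil.
  by rewrite (good_size gw) n0.
have [x [g [t [sh rt ew hx]]]] := good_decomp n0 gw.
have gt : good (n - g.+1) t by apply: (good_of_build sh rt); rewrite -ew.
have [q [sq dq eq]] := IH (n - g.+1) ltac:(lia) t gt.
have [p H] : exists p, Psi_rec n x g q p.
  by apply: Psi_rec_total => //; rewrite eq.
have [_ _ sp] := Psi_rec_shape H.
exists p; split=> //; first by rewrite (Psi_rec_dyck H).
by rewrite (Psi_rec_build H) eq.
Qed.

(** In each step of the recursion the height grows by [2 * (x == n)] and the tiny count by
    [x == n]. *)
Lemma height_tiny_count n p : size p = n.*2 -> dyck_from 0 p ->
  good n (Psi p) -> height p = Posz (2 * tiny_count n (Psi p)).
Proof.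
elim/ltn_ind: n p => n IH p sp dp gw; case: (posnP n) => [n0|n0].
  by move: sp; rewrite n0 => /size0nil ->; rewrite height_nil.
have [x [g [q H]]] := Psi_rec_exists n0 sp dp.
have [sh sq _] := Psi_rec_shape H.
have dq : dyck_from 0 q by rewrite -(Psi_rec_dyck H).
have rq := Psi_in_range sq dq.
move: gw; rewrite (Psi_rec_build H rq) => gw.
have gq := good_of_build sh rq gw.
rewrite (tiny_count_build sh gq gw (Psi_rec_head H)) (Psi_rec_height H).
by rewrite (IH (n - g.+1)) //; lia.
Qed.

Theorem theorem7 (n : nat) (s : 'S_(n.*2)) (hs : s \in C123 n) :
  height (Phi s) = Posz (2 * num_tiny_minima s).
Proof.
have gw := good_one_line hs; rewrite (num_tiny_minimaE gw).
(* The height formula applies to whichever preimage [pick] returns; surjectivity excludes the dummy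
   value. *)
rewrite /Phi; case: pickP => [p /andP[dp /eqP ep]|/= no].
  rewrite /= -ep; apply: height_tiny_count.
  - by rewrite size_tuple.
  - by rewrite -dyck_prefixE.
  - by rewrite ep.
have [p [sp dp ep]] := Psi_surj gw.
have /eqP sp' := sp.
by have := no (Tuple sp'); rewrite /= dyck_prefixE dp ep eqxx.
Qed.
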